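(* Let $\mathrm{Gr}_{\mathbf b}(k,n)$ be a divisive weighted Grassmann orbifold, with $b_i$ dividing $b_{i-1}$ for all $i=1,\dots,m$. Then the equivariant structure constants ${\bf b}\widetilde{\mathscr C}_{i\,j}^{\ell}$ lie in $\mathbb Z[y_1,y_2,\dots,y_n]$ for all $i,j,\ell\in\{0,1,\dots,m\}$.
   Context: Let $1\le k<n$ and $m+1=\binom nk$. A Schubert symbol for $k<n$ is a sequence $\lambda=(\lambda_1<\dots<\lambda_k)$ of integers in $\{1,\dots,n\}$ (identified with its underlying set). Write $\lambda\preceq\mu$ iff $\lambda_i\le\mu_i$ for all $i$, and fix a total order $\lambda^0<\lambda^1<\dots<\lambda^m$ of all Schubert symbols refining $\preceq$. With $e_1,\dots,e_n$ the standard basis of $\mathbb C^n$ and $e_\lambda=e_{\lambda_1}\wedge\dots\wedge e_{\lambda_k}$, identify $\Lambda^k(\mathbb C^n)$ with $\mathbb C^{m+1}$ by $z=\sum_i z_ie_{\lambda^i}$. Let $Pl(k,n)=\{a_1\wedge\dots\wedge a_k: a_i\in\mathbb C^n\}\setminus\{0\}$. $\mathbf b=(b_0,\dots,b_m)\in(\mathbb Z_{\ge1})^{m+1}$ is a Plücker weight vector if for all $1\le i_1<\dots<i_{k-1}\le n$ and $1\le\ell_0<\dots<\ell_k\le n$ the sum $b_{r_j}+b_{s_j}$ takes the same value for all $j\in\{0,\dots,k\}$ with $\ell_j\notin\{i_1,\dots,i_{k-1}\}$, where $\lambda^{r_j}=\{i_1,\dots,i_{k-1},\ell_j\}$ and $\lambda^{s_j}=\{\ell_0,\dots,\ell_k\}\setminus\{\ell_j\}$.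 For such $\mathbf b$, $\mathbb C^*$ acts on $Pl(k,n)$ by $t(z_0,\dots,z_m)=(t^{b_0}z_0,\dots,t^{b_m}z_m)$, and $\mathrm{Gr}_{\mathbf b}(k,n)$ is the orbit space with the quotient topology (a weighted Grassmann orbifold). A Plücker permutation is a permutation $\sigma$ of $\{0,\dots,m\}$ for which there are signs $t_i\in\{1,-1\}$ such that $(t_0z_{\sigma(0)},\dots,t_mz_{\sigma(m)})\in Pl(k,n)$ for every $z\in Pl(k,n)$; $\mathrm{Gr}_{\mathbf b}(k,n)$ is divisive if for some Plücker permutation $\sigma$, $b_{\sigma(i)}$ divides $b_{\sigma(i-1)}$ for all $i=1,\dots,m$. Up to homeomorphism one assumes (standing convention) that $b_i$ divides $b_{i-1}$ for all $i=1,\dots,m$. Put $d(\lambda)=\sum_{r=1}^k(\lambda_r-r)$. For $s\in\lambda$, $s'\notin\lambda$, $s<s'$, let $(s,s')\lambda$ be the symbol obtained by replacing $s$ by $s'$ in $\lambda$. Let $I(\lambda^i)$ be the set of all $(s,s')\lambda^i$, and $R(\lambda^i)=\{\lambda^j:\lambda^i\in I(\lambda^j)\}$. Put $Y_\lambda=\sum_{r=1}^ky_{\lambda_r}$. $T^n=(S^1)^n$ acts on $\mathrm{Gr}_{\mathbf b}(k,n)$ by $t\cdot[(z_i)]=[(t_{\lambda^i}z_i)]$, $t_\lambda=t_{\lambda_1}\cdots t_{\lambda_k}$, and $H^*_{T^n}(\mathrm{pt};\mathbb Z)=\mathbb Z[y_1,\dots,y_n]$. Restriction to the fixed points $[e_{\lambda^j}]$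 (written $\alpha|_{\lambda^j}=\alpha_j$) identifies (known) $$H^*_{T^n}(\mathrm{Gr}_{\mathbf b}(k,n);\mathbb Z)=\Big\{\alpha\in\bigoplus_{j=0}^m\mathbb Z[y_1,\dots,y_n]:\ \big(Y_{\lambda^i}-\tfrac{b_i}{b_j}Y_{\lambda^j}\big)\text{ divides }(\alpha_j-\alpha_i)\text{ whenever }\lambda^i\in R(\lambda^j)\Big\}.$$ The equivariant Schubert class ${\bf b}\widetilde{\mathbb S}_{\lambda^i}$ is the unique element with: (1) ${\bf b}\widetilde{\mathbb S}_{\lambda^i}|_{\lambda^j}\ne0\Rightarrow\lambda^j\succeq\lambda^i$; (2) ${\bf b}\widetilde{\mathbb S}_{\lambda^i}|_{\lambda^i}=\prod_{\lambda^\ell\in R(\lambda^i)}(Y_{\lambda^\ell}-\frac{b_\ell}{b_i}Y_{\lambda^i})$; (3) each ${\bf b}\widetilde{\mathbb S}_{\lambda^i}|_{\lambda^j}$ is a homogeneous polynomial in $y_1,\dots,y_n$ of degree $d(\lambda^i)$. These classes form a $\mathbb Q[y_1,\dots,y_n]$-basis of the ring with rational coefficients, and ${\bf b}\widetilde{\mathscr C}_{i\,j}^{\ell}\in\mathbb Q[y_1,\dots,y_n]$ are defined by ${\bf b}\widetilde{\mathbb S}_{\lambda^i}{\bf b}\widetilde{\mathbb S}_{\lambda^j}=\sum_{\ell=0}^m{\bf b}\widetilde{\mathscr C}_{i\,j}^{\ell}\,{\bf b}\widetilde{\mathbb S}_{\lambda^\ell}$. *)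

(* Defs.v *)
From HB Require Import structures.
From mathcomp Require Import all_boot all_order all_algebra all_fingroup.
From mathcomp Require Import mpoly complex.
From mathcomp Require Import reals.

Set Implicit Arguments.
Unset Strict Implicit.
Unset Printing Implicit Defensive.

Import GRing.Theory Num.Theory.
Local Open Scope ring_scope.

(* All indices are shifted by one: {1, ..., n} is 'I_n and the entries of a  *)
(* symbol are numbered from 0.                                               *)
Definition symbol (n k : nat) : Type := {A : {set 'I_n} | #|A| == k}.

HB.instance Definition _ n k := SubFinite.on (symbol n k).

(* [enum A] lists A in increasing order, so this is the r-th smallest        *)
(* element of A.                                                             *)
Definition entry (n k : nat) (A : symbol n k) (r : 'I_k) : 'I_n :=
  enum_val (cast_ord (esym (eqP (valP A))) r).

Definition symbol_le (n k : nat) (A B : symbol n k) : bool :=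
  [forall r : 'I_k, entry A r <= entry B r]%N.

(* The truncated subtraction is exact since r <= entry A r.                  *)
Definition sdim (n k : nat) (A : symbol n k) : nat :=
  (\sum_(r < k) (entry A r - r))%N.

Definition symbol_up (n k : nat) (A : symbol n k) : {set symbol n k} :=
  [set B : symbol n k | [exists s : 'I_n, exists s' : 'I_n,
     [&& s \in val A, s' \notin val A, (s < s')%N
       & val B == s' |: (val A :\ s)]]].

Definition symbol_down (n k : nat) (A : symbol n k) : {set symbol n k} :=
  [set B : symbol n k | A \in symbol_up B].

Definition symbol_enumeration (n k m : nat) (lam : 'I_m.+1 -> symbol n k) :
  Prop :=
  bijective lam /\
  forall i j : 'I_m.+1, symbol_le (lam i) (lam j) -> (i <= j)%N.

(* Here I = {i_1, ..., i_{k-1}}, L = {l_0, ..., l_k}, and x, y are two of    *)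
(* the l_j lying outside I.                                                  *)
Definition plucker_weight (n k m : nat) (lam : 'I_m.+1 -> symbol n k)
    (b : 'I_m.+1 -> nat) : Prop :=
  (forall i, (0 < b i)%N) /\
  (forall I L : {set 'I_n}, #|I| = k.-1 -> #|L| = k.+1 ->
   forall x y : 'I_n, x \in L :\: I -> y \in L :\: I ->
   forall rx sx ry sy : 'I_m.+1,
     val (lam rx) = x |: I -> val (lam sx) = L :\ x ->
     val (lam ry) = y |: I -> val (lam sy) = L :\ y ->
     (b rx + b sx = b ry + b sy)%N).

(* Coordinates of a_1 /\ ... /\ a_k in the basis (e_(lam i))_i of the k-th   *)
(* exterior power, the a_r being the rows of a: the coordinate on e_A is the *)
(* minor of a on the columns A.                                              *)
Definition wedge_coord (R : realType) (n k m : nat)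
    (lam : 'I_m.+1 -> symbol n k) (a : 'M[R[i]]_(k, n)) : 'rV[R[i]]_m.+1 :=
  \row_(i < m.+1) \det (\matrix_(r < k, c < k) a r (entry (lam i) c)).

Definition Pl (R : realType) (n k m : nat) (lam : 'I_m.+1 -> symbol n k)
    (z : 'rV[R[i]]_m.+1) : Prop :=
  z != 0 /\ exists a : 'M[R[i]]_(k, n), z = wedge_coord lam a.

Definition plucker_perm (R : realType) (n k m : nat)
    (lam : 'I_m.+1 -> symbol n k) (sigma : {perm 'I_m.+1}) : Prop :=
  exists t : 'I_m.+1 -> bool, forall z : 'rV[R[i]]_m.+1,
    Pl lam z -> Pl lam (\row_(i < m.+1) ((-1) ^+ t i * z 0 (sigma i))).

Definition divisive (R : realType) (n k m : nat)
    (lam : 'I_m.+1 -> symbol n k) (b : 'I_m.+1 -> nat) : Prop :=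
  exists2 sigma : {perm 'I_m.+1}, plucker_perm R lam sigma &
    forall i j : 'I_m.+1, j = i.+1 :> nat -> (b (sigma j) %| b (sigma i))%N.

Definition Y (n k : nat) (A : symbol n k) : {mpoly int[n]} :=
  \sum_(r < k) 'X_(entry A r).

(* Y_(lam i) - (b_i / b_j) Y_(lam j).  The natural-number quotient is exact  *)
(* under the convention that b_(i+1) divides b_i, since this is only used    *)
(* for lam i in symbol_down (lam j), whence i < j.                           *)
Definition edge_weight (n k m : nat) (lam : 'I_m.+1 -> symbol n k)
    (b : 'I_m.+1 -> nat) (i j : 'I_m.+1) : {mpoly int[n]} :=
  Y (lam i) - Y (lam j) *+ (b i %/ b j).

(* The image of the T^n-equivariant integral cohomology of the weighted      *)
(* Grassmann orbifold under restriction to its fixed points; the ring        *)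
(* operations are pointwise.                                                 *)
Definition equiv_cohomology (n k m : nat) (lam : 'I_m.+1 -> symbol n k)
    (b : 'I_m.+1 -> nat) (alpha : 'I_m.+1 -> {mpoly int[n]}) : Prop :=
  forall i j : 'I_m.+1, lam i \in symbol_down (lam j) ->
    exists g : {mpoly int[n]}, alpha j - alpha i = g * edge_weight lam b i j.

Definition schubert_class (n k m : nat) (lam : 'I_m.+1 -> symbol n k)
    (b : 'I_m.+1 -> nat) (i : 'I_m.+1) (S : 'I_m.+1 -> {mpoly int[n]}) :
  Prop :=
  [/\ equiv_cohomology lam b S,
      forall j, S j != 0 -> symbol_le (lam i) (lam j),
      S i = \prod_(l < m.+1 | lam l \in symbol_down (lam i))
              edge_weight lam b l i
    & forall j, S j \is (sdim (lam i)).-homog].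

Definition toQ (n : nat) (p : {mpoly int[n]}) : {mpoly rat[n]} :=
  map_mpoly (intr : int -> rat) p.

Definition structure_constants (n m : nat)
    (S : 'I_m.+1 -> 'I_m.+1 -> {mpoly int[n]})
    (C : 'I_m.+1 -> 'I_m.+1 -> 'I_m.+1 -> {mpoly rat[n]}) : Prop :=
  forall i j p : 'I_m.+1,
    toQ (S i p) * toQ (S j p) = \sum_(l < m.+1) C i j l * toQ (S l p).

(* Main.v *)
Require Import Defs.
From mathcomp Require Import all_boot all_order all_algebra all_fingroup.
From mathcomp Require Import mpoly complex.
From mathcomp Require Import reals zify.

(** The image of the equivariant cohomology is a ring, so it suffices that every
    alpha in it is an integral combination of Schubert classes. At the smallest
    index j where alpha_j is nonzero, each edge weight into j divides alpha_j.
    The edge weights into j are linear forms having some coefficient 1, hence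
    primes of Z[y_1, ..., y_n], and they are pairwise non-associate, so their
    product, the diagonal value of the j-th Schubert class, divides alpha_j.
    Subtract the corresponding multiple of that class and iterate; uniqueness of
    the coefficients over Q follows from triangularity. *)

Import Order.TTheory GRing.Theory.
Local Open Scope ring_scope.

(** * Divisibility by linear forms having a coefficient 1 *)

Definition linear_form {R : nzRingType} {n : nat} (u : 'I_n -> R) :
    {mpoly R[n]} := \sum_(t < n) u t *: 'X_t.

Lemma mcoeff_linear_form {R : nzRingType} {n : nat} (u : 'I_n -> R) (t : 'I_n) :
  (linear_form u)@_U_(t) = u t.
Proof.
rewrite raddf_sum (bigD1 t) //= mcoeffZ mcoeffXU eqxx mulr1 big1 ?addr0 //.
by move=> i it; rewrite mcoeffZ mcoeffXU (negbTE it) mulr0.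
Qed.

(* Substituting 'X_i by entry i amounts, when L has coefficient 1 at 'X_s, to
   computing modulo L by eliminating 'X_s. *)
Definition elim_var {R : nzRingType} {n : nat} (s : 'I_n) (L : {mpoly R[n]}) :
    n.-tuple {mpoly R[n]} := [tuple 'X_i - L *+ (i == s) | i < n].

Lemma elim_varX {R : nzRingType} {n : nat} (s i : 'I_n) (L : {mpoly R[n]}) :
  'X_i \mPo elim_var s L = 'X_i - L *+ (i == s).
Proof. by rewrite comp_mpolyXU -tnth_nth tnth_mktuple. Qed.

Lemma elim_var_linear {R : comNzRingType} {n : nat} (s : 'I_n) (u v : 'I_n -> R) :
  linear_form v \mPo elim_var s (linear_form u)
  = linear_form v - v s *: linear_form u.
Proof.
rewrite {1}/linear_form raddf_sum /=.
under eq_bigr do rewrite comp_mpolyZ elim_varX scalerBr.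
rewrite sumrB; congr (_ - _); rewrite (bigD1 s) //= eqxx mulr1n [X in _ + X]big1 ?addr0 //.
by move=> i /negbTE ->; rewrite mulr0n scaler0.
Qed.

(** The substitution moves each variable by a multiple of [L], and congruence modulo [L] is
    compatible with sums, products and scaling. *)
Lemma elim_var_mod {R : comNzRingType} {n : nat} (s : 'I_n)
    (L p : {mpoly R[n]}) :
  exists g, p - (p \mPo elim_var s L) = g * L.
Proof.
elim/mpolyind: p => [|c m p _ _ [g gE]].
  by exists 0; rewrite comp_mpoly0 subr0 mul0r.
suff [h hE] : exists h, 'X_[m] - ('X_[m] \mPo elim_var s L) = h * L.
  exists (c *: h + g); rewrite comp_mpolyD comp_mpolyZ mulrDl -gE -scalerAl -hE.
  by rewrite scalerBr opprD addrACA.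
rewrite mpolyXE_id rmorph_prod /=.
pose Q (x y : {mpoly R[n]}) := exists h, x - y = h * L.
apply: (big_ind2 Q) => [|x1 x2 y1 y2 [h1 E1] [h2 E2]|i _].
- by exists 0; rewrite subrr mul0r.
- exists (h1 * y1 + x2 * h2).
  by rewrite mulrDl mulrAC -E1 -mulrA -E2 mulrBl mulrBr addrA subrK.
rewrite rmorphXn /= elim_varX.
elim: (m i) => [|e [h hE]]; first by exists 0; rewrite !expr0 subrr mul0r.
(* With Z the image of X, this comes from X^(e+1) - Z^(e+1) = X^e (X - Z) + (X^e - Z^e) Z. *)
exists ('X_i ^+ e *+ (i == s) + h * ('X_i - L *+ (i == s))).
rewrite mulrDl mulrAC -hE mulrnAl -mulrnAr mulrBl addrA [in RHS]mulrBr.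
by rewrite [X in _ = X - _]addrC subrK !exprSr.
Qed.

(** This is the source of primality: divisibility becomes membership in the kernel of a ring
    morphism, whose target is a domain when [R] is one. *)
Lemma dvd_linear_formP {R : comNzRingType} {n : nat} (s : 'I_n) (u : 'I_n -> R)
    (p : {mpoly R[n]}) : u s = 1 ->
  (exists g, p = g * linear_form u) <->
  p \mPo elim_var s (linear_form u) = 0.
Proof.
move=> us; split=> [[g ->]|p0].
  by rewrite rmorphM /= elim_var_linear us scale1r subrr mulr0.
by have [g gE] := elim_var_mod s (linear_form u) p; exists g; rewrite -gE p0 subr0.
Qed.

(** Factors are added one at a time. The substitution attached to the new index [i] kills the
    cofactor times the earlier product, hence one of its factors; it cannot be an earlier form,
    since that would force [u j] to be [u j s] times [u i]. So the new form divides the cofactor. *)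
Lemma dvd_prod_linear_form {R : idomainType} {n : nat} {I : finType}
    (P : pred I) (u : I -> 'I_n -> R) (p : {mpoly R[n]}) :
  (forall i, P i -> exists2 s, u i s = 1 &
     forall j, P j -> i != j -> exists t, u j t != u j s * u i t) ->
  (forall i, P i -> exists g, p = g * linear_form (u i)) ->
  exists g, p = g * \prod_(i | P i) linear_form (u i).
Proof.
move=> uind pdvd.
suff H r : uniq r -> all P r ->
    exists g, p = g * \prod_(i <- r) linear_form (u i).
  have := H (enum P) (enum_uniq _); rewrite big_enum; apply.
  by apply/allP=> i; rewrite mem_enum.
elim: r => [|i r IHr] /=; first by exists p; rewrite big_nil mulr1.
case/andP=> ir /IHr {}IHr /andP[Pi Pr]; have [g gE] := IHr Pr.
have [s us1 us] := uind i Pi.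
have /(dvd_linear_formP _ _ _ us1) := pdvd i Pi.
rewrite gE rmorphM rmorph_prod /= => /eqP; rewrite mulf_eq0 => /orP[/eqP g0|].
  have /(dvd_linear_formP _ _ _ us1)[h ->] := g0.
  by exists h; rewrite big_cons mulrA.
rewrite prodf_seq_eq0 => /hasP[j jr /=]; rewrite elim_var_linear => /eqP E.
have ij : i != j by apply: contraNneq ir => ->.
have [t] := us j (allP Pr _ jr) ij.
have := congr1 (mcoeff U_(t)) E.
rewrite mcoeffB mcoeffZ !mcoeff_linear_form mcoeff0 => /eqP.
by rewrite subr_eq0 => ->.
Qed.

(** * Symbols, their order and their weights [Y] *)

Lemma entry_val {n k : nat} (A : symbol n k) (r : 'I_k) :
  val (entry A r) = nth 0%N (map val (enum (val A))) r.
Proof.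
rewrite /entry (enum_val_nth (entry A r)) (nth_map (entry A r)) //.
by rewrite -cardE (eqP (valP A)).
Qed.

Lemma sorted_val_enum {n : nat} (A : {set 'I_n}) :
  sorted ltn (map val (enum A)).
Proof.
rewrite {1}/enum_mem sorted_map sorted_filter //.
  by move=> x y z; apply: ltn_trans.
by rewrite -enumT -sorted_map val_enum_ord iota_ltn_sorted.
Qed.

(** Entry [r] of [A] is at most x once more than [r] elements of [A] are; with x the entry [r] of
    [B], the count for [B] is exactly [r + 1]. *)
Lemma symbol_le_card {n k : nat} (A B : symbol n k) :
  (forall x, #|[set b in val B | b <= x]| <= #|[set a in val A | a <= x]|)%N ->
  symbol_le A B.
Proof.
have cardE' (C : symbol n k) x :
    #|[set c in val C | (c <= x)%N]| = count (<= x)%O (map val (enum (val C))).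
  by rewrite cardsE cardE /enum_mem -size_filter filter_map size_map !size_filter
    count_filter; apply: eq_count => c; rewrite !inE /= leEnat andbC.
move=> cardAB; apply/forallP=> r; rewrite !entry_val.
have sz (C : symbol n k) : (r < size (map val (enum (val C))))%N.
  by rewrite size_map -cardE (eqP (valP C)).
apply: (@nth_count_le _ nat); first exact: sub_sorted ltnW _ (sorted_val_enum _).
rewrite -cardE'; apply: leq_trans (cardAB _).
by rewrite cardE' (count_le_nth _ (sorted_val_enum _)).
Qed.

(** The transposition of [s] and [s'] injects the elements of [B] up to x into those of [A]: it
    lowers [s'] to [s] and fixes the others. *)
Lemma symbol_up_le {n k : nat} (A B : symbol n k) :
  B \in symbol_up A -> symbol_le A B /\ A != B.
Proof.
rewrite inE => /existsP[s /existsP[s' /and4P[sA s'A ss' /eqP BE]]].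
split; last by apply: contraNneq s'A => ->; rewrite BE !inE eqxx.
apply: symbol_le_card => x.
rewrite -(card_imset _ (@perm_inj _ (tperm s s'))) subset_leq_card //.
apply/subsetP=> _ /imsetP[c + ->]; rewrite !inE BE !inE => /andP[cB cx].
case/orP: cB cx => [/eqP -> xs'|/andP[cs cA]].
  by rewrite tpermR sA (leq_trans (ltnW ss')).
by rewrite tpermD 1?eq_sym ?cA //; apply: contraNneq s'A => <-.
Qed.

Lemma Y_linear {n k : nat} (A : symbol n k) :
  Y A = linear_form (fun t => (t \in val A)%:R).
Proof.
rewrite /Y /linear_form.
transitivity (\sum_(t in val A) 'X_t : {mpoly int[n]}).
  rewrite (reindex (cast_ord (eqP (valP A)))) /=; last first.
    by exists (cast_ord (esym (eqP (valP A)))) => i _; rewrite ?cast_ordK ?cast_ordKV.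
  by rewrite [RHS]big_enum_val; apply: eq_bigr => r _; rewrite /entry cast_ordK.
rewrite big_mkcond; apply: eq_bigr => t _.
by case: (t \in val A); rewrite ?scale1r ?scale0r.
Qed.

(** * Edge weights and the ring of compatible families *)

Section Weighted.

Context {n k m : nat} (lam : 'I_m.+1 -> symbol n k) (b : 'I_m.+1 -> nat).
Hypothesis hlam : symbol_enumeration lam.

Definition edge_coef (j l : 'I_m.+1) (t : 'I_n) : int :=
  (t \in val (lam l))%:R - (t \in val (lam j))%:R *+ (b l %/ b j).

Lemma edge_weight_linear (j l : 'I_m.+1) :
  edge_weight lam b l j = linear_form (edge_coef j l).
Proof.
rewrite /edge_weight !Y_linear /linear_form -sumrMnl -sumrB.
by apply: eq_bigr => t _; rewrite scalerBl scalerMnl.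
Qed.

Lemma symbol_down_lt (j l : 'I_m.+1) :
  lam l \in symbol_down (lam j) -> (l < j)%N.
Proof.
rewrite inE => /symbol_up_le[/(hlam.2) le_lj ne_lj].
by rewrite ltn_neqAle le_lj andbT; apply: contraNneq ne_lj => /val_inj ->.
Qed.

Lemma prod_edge_dvd (j : 'I_m.+1) (p : {mpoly int[n]}) :
  (forall l, lam l \in symbol_down (lam j) ->
     exists g, p = g * edge_weight lam b l j) ->
  exists g, p = g * \prod_(l < m.+1 | lam l \in symbol_down (lam j))
                      edge_weight lam b l j.
Proof.
move=> pdvd; set P := fun l => lam l \in symbol_down (lam j).
(* Passing down from [lam j] to [lam l] removes [t] and inserts [s]; the edge form then has
   coefficient 1 at [s], where it will be eliminated. *)
have swap l : P l -> exists s t, [/\ s \in val (lam l), s \notin val (lam j),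
    t \in val (lam j) & val (lam l) = s |: (val (lam j) :\ t)].
  rewrite /P !inE => /existsP[s /existsP[s' /and4P[sA s'A ss' /eqP BE]]].
  exists s, s'; split; rewrite /= ?BE ?inE ?eqxx //.
    by rewrite orbF neq_ltn ss'.
  apply/setP=> t; rewrite !inE; have [->|ts] := eqVneq t s; first by rewrite sA.
  by have [->|] := eqVneq t s'; rewrite ?(negbTE s'A).
have [l1 Pl1|l Pl|g ->] := dvd_prod_linear_form P (edge_coef j) p.
- have [s1 [t1 [s1l s1j t1j E1]]] := swap l1 Pl1; exists s1.
    by rewrite /edge_coef s1l (negbTE s1j) mul0rn subr0.
  move=> l2 /swap[s2 [t2 [s2l s2j t2j E2]]] l12.
  (* If [s1] is not in [lam l2], the second form has coefficient 0 at [s1] but 1 at [s2]. *)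
  have [s1l2|s1l2] := boolP (s1 \in val (lam l2)); last first.
    exists s2; rewrite /edge_coef s2l (negbTE s1l2) (negbTE s2j) (negbTE s1j).
    by rewrite !mul0rn subr0 mul0r oner_eq0.
  have s12 : s1 = s2 by move: s1l2; rewrite E2 !inE (negbTE s1j) andbF orbF => /eqP.
  have t12 : t1 != t2.
    apply: contraNneq l12 => t12; apply/eqP/(bij_inj hlam.1)/val_inj.
    by rewrite E1 E2 s12 t12.
  have [t1s1 t2s1] : t1 != s1 /\ t2 != s1 by split; apply: contraNneq s1j => <-.
  have -> : edge_coef j l2 s1 = 1 by rewrite /edge_coef s1l2 (negbTE s1j) mul0rn subr0.
  (* With c, d the two weight quotients, equality at both t1 and t2 would give
     d = c + 1 and c = d + 1. *)
  have [e|e] := eqVneq (edge_coef j l2 t1) (edge_coef j l1 t1).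
    exists t2; rewrite mul1r; move: e; rewrite /edge_coef E1 E2 -s12 !inE t1j t2j.
    rewrite !eqxx (negbTE t1s1) (negbTE t2s1) (eq_sym t2) (negbTE t12) /=.
    move: (b l1 %/ b j)%N (b l2 %/ b j)%N; clear => c d.
    by rewrite !pmulrn !intz; lia.
  by exists t1; rewrite mul1r.
- by have [g] := pdvd l Pl; rewrite edge_weight_linear; exists g.
by exists g; congr (_ * _); apply: eq_bigr => l _; rewrite edge_weight_linear.
Qed.

Lemma equiv_cohomologyB (alpha beta : 'I_m.+1 -> {mpoly int[n]}) :
  equiv_cohomology lam b alpha -> equiv_cohomology lam b beta ->
  equiv_cohomology lam b (fun p => alpha p - beta p).
Proof.
move=> Ha Hb i j ij; have [g gE] := Ha i j ij; have [h hE] := Hb i j ij.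
by exists (g - h); rewrite mulrBl -gE -hE !opprD !opprK addrACA.
Qed.

Lemma equiv_cohomologyM (alpha beta : 'I_m.+1 -> {mpoly int[n]}) :
  equiv_cohomology lam b alpha -> equiv_cohomology lam b beta ->
  equiv_cohomology lam b (fun p => alpha p * beta p).
Proof.
move=> Ha Hb i j ij; have [g gE] := Ha i j ij; have [h hE] := Hb i j ij.
exists (g * beta j + alpha i * h).
by rewrite mulrDl mulrAC -gE -mulrA -hE mulrBl mulrBr addrA subrK.
Qed.

Lemma equiv_cohomologyZ (c : {mpoly int[n]}) (alpha : 'I_m.+1 -> {mpoly int[n]}) :
  equiv_cohomology lam b alpha ->
  equiv_cohomology lam b (fun p => c * alpha p).
Proof. by apply: equiv_cohomologyM => i j _; exists 0; rewrite subrr mul0r. Qed.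

(** * Expansion in Schubert classes *)

Section SchubertBasis.

Variable S : 'I_m.+1 -> 'I_m.+1 -> {mpoly int[n]}.
Hypothesis hS : forall i, schubert_class lam b i (S i).

Lemma schubert_lt0 (l p : 'I_m.+1) : (p < l)%N -> S l p = 0.
Proof.
move=> pl; apply/eqP; apply: contraLR pl => Slp; rewrite -leqNgt.
by have [_ supp _ _] := hS l; apply: hlam.2; apply: supp.
Qed.

(** Each factor of the diagonal value has coefficient 1 at the index that the lower symbol loses on
    the way up to [lam l]. *)
Lemma schubert_diag_neq0 (l : 'I_m.+1) : S l l != 0.
Proof.
have [_ _ -> _] := hS l; apply/prodf_neq0 => i.
rewrite edge_weight_linear !inE => /existsP[s /existsP[s' /and4P[si _ ss' /eqP E]]].
have sl : s \notin val (lam l) by rewrite E !inE eqxx /= orbF neq_ltn ss'.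
apply/eqP=> /(congr1 (mcoeff U_(s))); rewrite mcoeff_linear_form mcoeff0.
by rewrite /edge_coef si (negbTE sl) mul0rn subr0; apply/eqP/oner_neq0.
Qed.

Lemma schubert_span (alpha : 'I_m.+1 -> {mpoly int[n]}) :
  equiv_cohomology lam b alpha ->
  exists c : 'I_m.+1 -> {mpoly int[n]},
    forall p, alpha p = \sum_(l < m.+1) c l * S l p.
Proof.
move=> Ha.
suff H d : (d <= m.+1)%N -> exists c : 'I_m.+1 -> {mpoly int[n]},
    forall p : 'I_m.+1, (p < d)%N -> alpha p = \sum_(l < m.+1) c l * S l p.
  by have [c cE] := H m.+1 (leqnn _); exists c => p; apply: cE.
elim: d => [|d IHd] dm; first by exists (fun=> 0).
have [c cE] := IHd (ltnW dm); pose j := Ordinal dm.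
pose gamma p := alpha p - \sum_(l < m.+1) c l * S l p.
have Hg : equiv_cohomology lam b gamma.
  apply: equiv_cohomologyB => // i i' ii'.
  apply: (big_ind2 (fun x y => exists g, x - y = g * edge_weight lam b i i')).
  - by exists 0; rewrite subrr mul0r.
  - move=> x1 x2 y1 y2 [g gE] [h hE]; exists (g + h).
    by rewrite mulrDl -gE -hE opprD addrACA.
  by move=> l _; have [Hl _ _ _] := hS l; apply: equiv_cohomologyZ Hl i i' ii'.
(* As [gamma] vanishes before [j], its congruences along the edges into [j] are plain divisibilities
   of [gamma j]. *)
have [l|g gE] := prod_edge_dvd j (gamma j).
  move=> lj; have [h] := Hg _ _ lj; rewrite {2}/gamma -cE ?subrr ?subr0.
    by exists h.
  exact: symbol_down_lt lj.
have [_ _ Sjj _] := hS j; rewrite -Sjj in gE.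
(* The correction does not disturb the indices before [j], where [S j] is zero. *)
exists (fun l => c l + g *+ (l == j)) => p.
rewrite ltnS; under eq_bigr do rewrite mulrDl.
rewrite big_split /= [X in _ + X](bigD1 j) //= eqxx mulr1n [X in g * _ + X]big1 => [|i /negbTE ->].
  rewrite addr0 leq_eqVlt => /predU1P[pd|pd].
    by have -> : p = j by [apply: val_inj]; rewrite -gE addrC subrK.
  by rewrite schubert_lt0 // mulr0 addr0 cE.
by rewrite mulr0n mul0r.
Qed.

(** Strong induction on [l], reading the relation at the fixed point [l]: earlier terms vanish by
    induction and later ones by support, which leaves [f l] times a nonzero diagonal value. *)
Lemma schubert_free (f : 'I_m.+1 -> {mpoly rat[n]}) :
  (forall p, \sum_(l < m.+1) f l * toQ (S l p) = 0) -> forall l, f l = 0.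
Proof.
move=> f0 l; have [d] := ubnP (val l); elim: d l => // d IHd l; rewrite ltnS => ld.
have := f0 l; rewrite (bigD1 l) //= big1 ?addr0 => [|i il].
  move/eqP; rewrite mulf_eq0 => /orP[/eqP //|].
  move=> /eqP Sll0; case/negP: (schubert_diag_neq0 l); apply/eqP/mpolyP=> mon.
  apply: (@intr_inj rat); have := congr1 (mcoeff mon) Sll0.
  by rewrite mcoeff_map_mpoly !mcoeff0.
case: (ltngtP i l) il => [il|il|/val_inj ->]; last by rewrite eqxx.
  by rewrite IHd ?mul0r //; apply: leq_trans il ld.
by rewrite schubert_lt0 // /toQ rmorph0 mulr0.
Qed.

End SchubertBasis.

End Weighted.

Theorem theoremD (R : realType) (n k m : nat)
    (hk : (1 <= k)%N) (hkn : (k < n)%N) (hm : m.+1 = 'C(n, k))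
    (lam : 'I_m.+1 -> symbol n k) (hlam : symbol_enumeration lam)
    (b : 'I_m.+1 -> nat) (hb : plucker_weight lam b)
    (hdiv : divisive R lam b)
    (hdvd : forall i j : 'I_m.+1, j = i.+1 :> nat -> (b j %| b i)%N)
    (S : 'I_m.+1 -> 'I_m.+1 -> {mpoly int[n]})
    (hS : forall i, schubert_class lam b i (S i))
    (C : 'I_m.+1 -> 'I_m.+1 -> 'I_m.+1 -> {mpoly rat[n]})
    (hC : structure_constants S C) :
  forall i j l : 'I_m.+1, exists c : {mpoly int[n]}, C i j l = toQ c.
Proof.
move=> i j l.
have [Si _ _ _] := hS i; have [Sj _ _ _] := hS j.
have [c cE] := schubert_span _ _ hlam _ hS _ (equiv_cohomologyM _ _ _ _ Si Sj).
exists (c l); apply/eqP; rewrite -subr_eq0; apply/eqP.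
(* The rational and the integral coefficients expand the same product, so their difference is a
   relation among the classes. *)
apply: (schubert_free lam b hlam S hS (fun l => C i j l - toQ (c l))) => p.
under eq_bigr do rewrite mulrBl.
rewrite sumrB -hC -[toQ (S i p) * _]rmorphM /= cE rmorph_sum /=.
by apply/eqP; rewrite subr_eq0; apply/eqP; apply: eq_bigr => q _; rewrite rmorphM.
Qed.
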